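(* Let $G$ be a finite daisy cube, let $\mathcal B(G)$ be the set of its two-sided peripheral $\Theta$-classes, and put $b=|\mathcal B(G)|$. Then there is a daisy cube $G_0$, unique up to isomorphism, such that $$G\cong G_0\square Q_b,$$ where $G_0$ has no two-sided peripheral $\Theta$-class and has a unique daisy root $r_0$. Under this decomposition, $$\mathcal R(G)=\{r_0\}\times V(Q_b),$$ where $\mathcal R(G)$ is the set of daisy roots of $G$. In particular, the subgraph $G[\mathcal R(G)]$ of $G$ induced by $\mathcal R(G)$ is a convex $b$-cube and $|\mathcal R(G)|=2^b$.
   Context: All graphs are finite, simple and connected. $Q_n$ is the hypercube on $\{0,1\}^n$ ($Q_0=K_1$), and $\square$ is the Cartesian product of graphs. A partial cube is a graph isomorphic to an isometric (distance-preserving) subgraph of a hypercube. For edges $ab,xy$ of a partial cube $G$, $ab\,\Theta\,xy$ iff $d(a,x)+d(b,y)\ne d(a,y)+d(b,x)$; this is an equivalence relation on $E(G)$ whose classes are the $\Theta$-classes. Their number $m$ is the isometric dimension of $G$. The $\Theta$-class of an edge $ab$ determines two complementary halfspaces $W_{ab}=\{x:d(a,x)<d(b,x)\}$ and $W_{ba}=\{x:d(b,x)<d(a,x)\}$, and consists exactly of the edges joining them. For a $\Theta$-class $\theta$ and one of its halfspaces $W$, let $U(\theta,W)=\{x\in W: x \text{ is incident with an edge of }\theta\}$. The class $\theta$ is two-sided peripheral if $U(\theta,W)=W$ for both of its halfspaces $W$. A set $D\subseteq\{0,1\}^n$ is a down-set if $x\in D$ and $y\le x$ coordinatewise imply $y\in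 D$. A daisy cube is a graph isomorphic to the induced subgraph $Q_n[D]$ for some $n\ge0$ and some nonempty down-set $D\subseteq\{0,1\}^n$ (every daisy cube is a partial cube). A vertex $r$ of a daisy cube $G$ of isometric dimension $m$ is a daisy root if there is an isometric embedding $\lambda:V(G)\to\{0,1\}^m$ (into $Q_m$) such that $\lambda(V(G))$ is a down-set and $\lambda(r)=0^m$. *)

(* Defs.v *)
From HB Require Import structures.
From mathcomp Require Import all_boot.

Set Implicit Arguments.
Unset Strict Implicit.
Unset Printing Implicit Defensive.

(* Connectedness is not a field, because induced subgraphs may be
   disconnected; every daisy cube is connected. *)
Record sgraph := SGraph {
  vertex :> finType;
  adj : rel vertex;
  adj_sym : symmetric adj;
  adj_irrefl : irreflexive adj }.

Arguments adj {s} _ _.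

Definition graph_iso (G H : sgraph) (f : G -> H) : Prop :=
  bijective f /\ forall x y : G, adj (f x) (f y) = adj x y.

Definition isomorphic (G H : sgraph) : Prop :=
  exists f : G -> H, graph_iso f.

Section Induced.
Variables (G : sgraph) (A : {set G}).

Definition induced_adj : rel {x : G | x \in A} :=
  fun u v => adj (val u) (val v).

Fact induced_adj_sym : symmetric induced_adj.
Proof. by move=> u v; apply: adj_sym. Qed.

Fact induced_adj_irrefl : irreflexive induced_adj.
Proof. by move=> u; apply: adj_irrefl. Qed.

Definition induced : sgraph := SGraph induced_adj_sym induced_adj_irrefl.
End Induced.

Section Box.
Variables G H : sgraph.

Definition box_adj : rel (G * H)%type := fun u v =>
  (u.1 == v.1) && adj u.2 v.2 || (u.2 == v.2) && adj u.1 v.1.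

Fact box_adj_sym : symmetric box_adj.
Proof.
move=> u v; rewrite /box_adj (eq_sym u.1) (eq_sym u.2).
by rewrite (adj_sym u.1) (adj_sym u.2).
Qed.

Fact box_adj_irrefl : irreflexive box_adj.
Proof. by move=> u; rewrite /box_adj !adj_irrefl !andbF. Qed.

Definition box : sgraph := SGraph box_adj_sym box_adj_irrefl.
End Box.

Section Cube.
Variable n : nat.

Definition cube_adj : rel {ffun 'I_n -> bool} :=
  fun x y => #|[set i | x i != y i]| == 1.

Fact cube_adj_sym : symmetric cube_adj.
Proof.
move=> x y; rewrite /cube_adj; congr (_ == 1).
by apply: eq_card => i; rewrite !inE eq_sym.
Qed.

Fact cube_adj_irrefl : irreflexive cube_adj.
Proof.
move=> x; rewrite /cube_adj (_ : [set i | _] = set0) ?cards0 //.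
by apply/setP=> i; rewrite !inE eqxx.
Qed.

Definition cube : sgraph := SGraph cube_adj_sym cube_adj_irrefl.

Definition cube0 : cube := [ffun=> false].

Definition down_set (D : {set cube}) : bool :=
  [forall x in D, forall y : cube, [forall i, y i ==> x i] ==> (y \in D)].
End Cube.

(* Length of a shortest walk from x to y; such a walk has fewer than #|G|
   edges.  When there is none, the value is #|G|. *)
Definition gdist (G : sgraph) (x y : G) : nat :=
  find (fun k => [exists p : k.-tuple G, path adj x p && (last x p == y)])
       (iota 0 #|G|).

Definition isometric (G H : sgraph) (f : G -> H) : bool :=
  [forall x, forall y, gdist (f x) (f y) == gdist x y].

Definition convex (G : sgraph) (A : {set G}) : bool :=
  [forall x in A, forall y in A, forall z,
     (gdist x z + gdist z y == gdist x y) ==> (z \in A)].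

Section Theta.
Variable G : sgraph.

Definition edges : {set {set G}} :=
  [set [set u.1; u.2] | u in [set u : G * G | adj u.1 u.2]].

(* The condition on distances does not change when a and b, or x and y, are
   exchanged, so it does not depend on how the edges e and f are written. *)
Definition Theta : rel {set G} := fun e f =>
  [exists a, exists b, exists x, exists y,
    [&& e == [set a; b], f == [set x; y] &
        gdist a x + gdist b y != gdist a y + gdist b x]].

Definition Theta_classes : {set {set {set G}}} :=
  equivalence_partition Theta edges.

Definition isodim : nat := #|Theta_classes|.

Definition halfspace (a b : G) : {set G} := [set x | gdist a x < gdist b x].

Definition halfspaces (theta : {set {set G}}) : {set {set G}} :=
  [set halfspace u.1 u.2 | u in [set u : G * G | [set u.1; u.2] \in theta]].

Definition peripheral_part (theta : {set {set G}}) (W : {set G}) : {set G} :=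
  [set x in W | [exists e in theta, x \in e]].

Definition two_sided_peripheral (theta : {set {set G}}) : bool :=
  [forall W in halfspaces theta, peripheral_part theta W == W].

Definition two_sided_classes : {set {set {set G}}} :=
  [set theta in Theta_classes | two_sided_peripheral theta].

Definition daisy_root (r : G) : bool :=
  [exists lam : {ffun G -> cube isodim},
    [&& isometric lam, down_set (lam @: [set: G]) & lam r == cube0 isodim]].

Definition daisy_roots : {set G} := [set r | daisy_root r].
End Theta.

Definition daisy_cube (G : sgraph) : Prop :=
  exists n : nat, exists D : {set cube n},
    [/\ D != set0, down_set D & isomorphic G (induced D)].

(* Main.v *)
Require Import Defs.
From HB Require Import structures.
From mathcomp Require Import all_boot.
From mathcomp Require Import zify.

(** Everything is read off from daisy coordinates: an injective labelling [f] of
the vertices by boolean vectors whose image is a down-set and for which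
adjacency means differing in one coordinate.  Graph distance is then Hamming
distance, because one can always walk from [x] to [y] inside a down-set by
first switching off the coordinates of [x] outside [y] ([gdist_coords]).
Consequently two edges are Theta-related exactly when they vary in the same
coordinate, so Theta-classes correspond to the coordinates that occur
([Theta_classes_coord]), and a class is two-sided peripheral exactly when the
image is closed under flipping its coordinate.  Such coordinates are called
free ([two_sided_classes_coord]).

The heart of the matter is that [r] is a daisy root if and only if the support
of [f r] consists of free coordinates ([daisy_rootsP]).  If it does, the
translation by [f r] preserves the image and moves [r] to the origin.
Conversely, let [g] be daisy coordinates with [g r = 0].  A coordinate [i] of
[f] and the coordinate [j] of [g] naming the same Theta-class cut the vertices
into the same two halves ([coord_change]); a vertex [x] on the other side of
[i] from [r] has [g x j = 1], so [j] can be switched off at [x], and this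
flips [i].  Hence a coordinate [i] in the support of [f r] is free: a vertex
on the side of [r] has it on, and it can be switched off in [f] itself.

The factor [G0] is the set of vertices whose free coordinates all vanish.
Recording the free coordinates separately gives the isomorphism
[G ~ G0 [] Q_b] ([core_splitting]); no coordinate of [G0] is free, so its only
root is the origin.  For any decomposition [G ~ H [] Q_b] with [H] daisy, the
count of two-sided classes forces [H] to have none, hence one root [rH], and
the roots of [G] form the fibre over [rH].  The vertices for which a fixed root
[r] is a nearest root are then exactly the copy of [H] through [r]
([gate_set_box_cube]).  Since nearest roots do not refer to the decomposition,
[H] is determined up to isomorphism. *)

Set Implicit Arguments.
Unset Strict Implicit.
Unset Printing Implicit Defensive.

(** * Finite sets, edges and distances *)

Lemma inj_onto_bij (S T : finType) (f : S -> T) :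
  injective f -> (forall y, exists x, f x = y) -> bijective f.
Proof.
move=> inj_f onto_f; apply: inj_card_bij => //.
rewrite -(card_codom inj_f); apply/subset_leq_card/subsetP=> y _.
by have [x <-] := onto_f y; apply: codom_f.
Qed.

Lemma set2_inj (T : finType) (a b c d : T) :
  a != b -> [set a; b] = [set c; d] -> (c = a /\ d = b) \/ (c = b /\ d = a).
Proof.
move=> ab /setP E; have := E a; have := E b; have := E c; have := E d.
rewrite !inE !eqxx !orbT /= => /orP Hd /orP Hc /esym/orP Hb /esym/orP Ha.
move: ab; case: Hd => /eqP Hd; case: Hc => /eqP Hc; subst; rewrite ?eqxx; auto.
- by case: Hb => /eqP ->; rewrite eqxx.
- by case: Ha => /eqP ->; rewrite eqxx.
Qed.

Lemma adj_neq (G : sgraph) (x y : G) : adj x y -> x != y.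
Proof. by move=> xy; apply: contraTneq xy => ->; rewrite adj_irrefl. Qed.

Lemma mem_edges (G : sgraph) (a b : G) : ([set a; b] \in edges G) = adj a b.
Proof.
apply/imsetP/idP => [[[c d]]|ab]; last by exists (a, b); rewrite ?inE.
rewrite inE /= => cd /esym/(set2_inj (adj_neq cd)) [[-> ->]|[-> ->]] //.
by rewrite adj_sym.
Qed.

Lemma edgesP (G : sgraph) (e : {set G}) :
  reflect (exists a b, e = [set a; b] /\ adj a b) (e \in edges G).
Proof.
apply: (iffP imsetP) => [[[a b]]|[a [b [-> ab]]]].
  by rewrite inE => ab ->; exists a, b.
by exists (a, b); rewrite ?inE.
Qed.

(** Removing the loops of a walk makes it shorter than the number of
vertices, so that its length lies in the range searched by [gdist]. *)
Lemma gdist_spec (G : sgraph) (x : G) (p : seq G) :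
  path adj x p ->
  gdist x (last x p) <= size p /\
  exists q, [/\ path adj x q, last x q = last x p & size q = gdist x (last x p)].
Proof.
case/shortenP=> p' path_p' uniq_p' sub_p'; set y := last x p'.
have lt_p' : size p' < #|G|.
  by have /card_uniqP/= <- := uniq_p'; apply: max_card.
have le_p' : size p' <= size p.
  by apply: uniq_leq_size => //; case/andP: uniq_p'.
have test_p' : [exists t : (size p').-tuple G, path adj x t && (last x t == y)].
  by apply/existsP; exists (in_tuple p'); rewrite /= path_p' eqxx.
have le_d : gdist x y <= size p'.
  rewrite leqNgt; apply/negP=> /(before_find 0).
  by rewrite nth_iota // add0n test_p'.
split; first exact: leq_trans le_d le_p'.
have lt_d : gdist x y < size (iota 0 #|G|).
  by rewrite size_iota (leq_ltn_trans le_d).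
have := lt_d; rewrite -has_find => /(nth_find 0); rewrite -/(gdist x y).
rewrite size_iota in lt_d; rewrite nth_iota // add0n.
case/existsP=> t /andP[path_t /eqP last_t].
by exists t; rewrite path_t last_t size_tuple.
Qed.

(** * Boolean vectors *)

Section Hamming.
Variable I : finType.
Implicit Types x y z a : {ffun I -> bool}.

Definition hamming x y := \sum_i (x i != y i).
Definition flip i x : {ffun I -> bool} := [ffun k => x k (+) (k == i)].
Definition shift a x : {ffun I -> bool} := [ffun k => x k (+) a k].
Definition zerov : {ffun I -> bool} := [ffun=> false].

Lemma hammingE x y : hamming x y = #|[set i | x i != y i]|.
Proof.
by rewrite -sum1dep_card big_mkcond; apply: eq_bigr => i _; case: (x i != y i).
Qed.

Lemma hamming_sym x y : hamming x y = hamming y x.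
Proof. by apply: eq_bigr => i _; rewrite eq_sym. Qed.

Lemma hamming_triangle x y z : hamming x z <= hamming x y + hamming y z.
Proof.
rewrite -big_split; apply: leq_sum => i _ /=.
by case: (x i) (y i) (z i) => [] [] [].
Qed.

Lemma hamming_eq0 x y : (hamming x y == 0) = (x == y).
Proof.
rewrite sum_nat_eq0; apply/forallP/eqP=> [xy|-> i]; last by rewrite eqxx.
by apply/ffunP=> i; have := xy i; rewrite eqb0 negbK => /eqP.
Qed.

Lemma flipK i : involutive (flip i).
Proof. by move=> x; apply/ffunP=> k; rewrite !ffunE addbK. Qed.

Lemma shiftK a : involutive (shift a).
Proof. by move=> x; apply/ffunP=> k; rewrite !ffunE addbK. Qed.

Lemma hamming_shift a x y : hamming (shift a x) (shift a y) = hamming x y.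
Proof.
by apply: eq_bigr => i _; rewrite !ffunE; case: (a i) (x i) (y i) => [] [] [].
Qed.

Lemma hamming1P x y : reflect (exists i, y = flip i x) (hamming x y == 1).
Proof.
rewrite hammingE; apply: (iffP cards1P) => [[i xy]|[i ->]]; exists i.
  apply/ffunP=> k; move/setP/(_ k): xy; rewrite !inE !ffunE => <-.
  by case: (x k) (y k) => [] [].
by apply/setP=> k; rewrite !inE ffunE; case: (x k) (k == i) => [] [].
Qed.

Lemma hamming_flip i x y :
  x i != y i -> hamming x y = (hamming (flip i x) y).+1.
Proof.
move=> xy; rewrite /hamming (bigD1 i) //= [in RHS](bigD1 i) //= !ffunE eqxx.
rewrite (eq_bigr (fun k => flip i x k != y k : nat)); last first.
  by move=> k /negPf ki; rewrite ffunE ki addbF.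
by move: xy; case: (x i) (y i) => [] [].
Qed.

(** Otherwise flipping [z] at [i] would bring it closer to both [x] and [y],
against the triangle inequality. *)
Lemma hamming_between x y z i :
  hamming x z + hamming z y = hamming x y -> x i = y i -> z i = x i.
Proof.
move=> Exy xyi; apply/eqP/negPn/negP=> zxi.
have := hamming_triangle x (flip i z) y.
have -> : hamming x y = (hamming x (flip i z) + hamming (flip i z) y).+2.
  rewrite -Exy (hamming_sym x z) (hamming_flip zxi).
  by rewrite (@hamming_flip i z y) -?xyi // (hamming_sym x (flip i z)) addSn addnS.
by lia.
Qed.

End Hamming.

(** * Daisy coordinates *)

(** The labels live over an arbitrary finite type, and coordinates that vanish
identically are allowed: products then have coordinates over a disjoint sum,
and subgraphs keep the coordinates of the ambient graph. *)
Record coords (G : sgraph) (I : finType) (f : G -> {ffun I -> bool}) : Prop :=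
  Coords {
    coords_inj : injective f;
    coords_adj : forall x y, adj x y = (hamming (f x) (f y) == 1);
    coords_down : forall x (v : {ffun I -> bool}),
      (forall i, v i -> f x i) -> exists y, f y = v;
    coords_inhab : exists x : G, True }.

Arguments coords_down {G I f} _ x v _.

Section CoordTheory.
Variables (G : sgraph) (I : finType) (f : G -> {ffun I -> bool}).
Hypothesis cf : coords f.

Lemma coords_zero : exists o, f o = zerov I.
Proof.
by case: (coords_inhab cf) => x _; apply: (coords_down cf x) => i; rewrite ffunE.
Qed.

Lemma coords_drop x i : f x i -> exists y, f y = flip i (f x).
Proof.
move=> xi; apply: (coords_down cf x) => k; rewrite ffunE.
by case: eqP => [->|_]; rewrite ?xi ?addbF.
Qed.

(** The step from [x] towards [y] switches off a coordinate of [x] absent from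
[y] if there is one; otherwise [x] lies below [y], and switching on a coordinate
of [y] stays below [y]. *)
Lemma coords_step x y :
  x != y -> exists z, adj x z /\ hamming (f x) (f y) = (hamming (f z) (f y)).+1.
Proof.
move=> xy.
have step i : f x i != f y i -> (exists z, f z = flip i (f x)) ->
    exists z, adj x z /\ hamming (f x) (f y) = (hamming (f z) (f y)).+1.
  move=> xyi [z fz]; exists z; rewrite (coords_adj cf) fz -hamming_flip //.
  by split=> //; apply/hamming1P; exists i.
case: (pickP (fun i => f x i && ~~ f y i)) => [i /andP[xi yi]|le_xy].
  by apply: (step i); [rewrite xi (negPf yi) | apply: coords_drop].
have [i xyi] : exists i, f x i != f y i.
  apply/existsP; apply: contraR xy => /existsPn xy; apply/eqP/(coords_inj cf).
  by apply/ffunP=> i; apply/eqP/negPn/xy.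
apply: (step i) => //; apply: (coords_down cf y) => k; rewrite ffunE.
have := le_xy k; have := le_xy i; case: eqP => [->|_]; move: xyi.
  by case: (f x i) (f y i) => [] [].
by case: (f x k) (f y k) => [] [].
Qed.

Lemma gdist_coords x y : gdist x y = hamming (f x) (f y).
Proof.
have [p [path_p last_p size_p]] : exists p,
    [/\ path adj x p, last x p = y & size p = hamming (f x) (f y)].
  have [n] := ubnP (hamming (f x) (f y)); elim: n x => // n IHn x le_n.
  have [->|xy] := eqVneq x y.
    by exists [::]; split=> //; apply/esym/eqP; rewrite hamming_eq0.
  have [z [xz Ez]] := coords_step xy.
  have [|p [path_p last_p size_p]] := IHn z; first by rewrite -Ez.
  by exists (z :: p); rewrite /= xz Ez size_p.
have lower q : path adj x q -> hamming (f x) (f (last x q)) <= size q.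
  elim: q {p path_p last_p size_p} x => [|z q IHq] x /=.
    by move=> _; rewrite leqn0 hamming_eq0.
  case/andP; rewrite (coords_adj cf) => /eqP xz /IHq.
  by have := hamming_triangle (f x) (f z) (f (last z q)); rewrite xz; lia.
have [] := gdist_spec path_p; rewrite last_p size_p => le_d [q [path_q last_q size_q]].
by apply/eqP; rewrite eqn_leq le_d -size_q -last_q lower.
Qed.

Definition used : {set I} := [set i | [exists x, f x i]].
(** Flipping off is always possible in a down-set, so the condition really says
that [i] can be switched on at every vertex. *)
Definition free : {set I} := [set i | [forall x, exists y, f y == flip i (f x)]].

Lemma freeP i : reflect (forall x, exists y, f y = flip i (f x)) (i \in free).
Proof.
rewrite inE; apply: (iffP forallP) => fi x.
  by have /existsP[y /eqP] := fi x; exists y.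
by have [y fy] := fi x; apply/existsP; exists y; apply/eqP.
Qed.

Lemma free_sub_used : free \subset used.
Proof.
apply/subsetP=> i /freeP fi; have [o fo] := coords_zero.
have [y fy] := fi o; rewrite inE; apply/existsP; exists y.
by rewrite fy fo !ffunE eqxx.
Qed.

(** Flip the coordinates of [a] one after the other. *)
Lemma coords_shift (a : {ffun I -> bool}) x :
  (forall i, a i -> i \in free) -> exists y, f y = shift a (f x).
Proof.
move=> a_free.
(* [s] lists the coordinates treated so far. *)
suff main s : uniq s ->
    exists y, f y = [ffun k => f x k (+) (a k && (k \in s))].
  have [y fy] := main _ (enum_uniq I); exists y; rewrite fy.
  by apply/ffunP=> k; rewrite !ffunE mem_enum andbT.
elim: s => [_|i s IHs /= /andP[i_s /IHs[y fy]]].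
  by exists x; apply/ffunP=> k; rewrite ffunE andbF addbF.
have [ai|nai] := boolP (a i).
  have /freeP/(_ y)[z fz] := a_free i ai; exists z; rewrite fz fy.
  apply/ffunP=> k; rewrite !ffunE inE; case: (eqVneq k i) => [->|_] /=.
    by rewrite ai (negPf i_s) addbF.
  by rewrite addbF.
exists y; rewrite fy; apply/ffunP=> k; rewrite !ffunE inE.
by case: (eqVneq k i) => [->|_] //=; rewrite (negPf nai).
Qed.

(** * Coordinates and Theta-classes *)

Definition coord_class i : {set {set G}} :=
  [set [set u.1; u.2] | u in [set u : G * G | adj u.1 u.2 & f u.1 i != f u.2 i]].

Lemma mem_coord_class (a b : G) i :
  ([set a; b] \in coord_class i) = adj a b && (f a i != f b i).
Proof.
apply/imsetP/andP => [[[c d]]|[ab abi]]; last by exists (a, b); rewrite ?inE ?ab.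
rewrite inE /= => /andP[cd cdi] /esym/(set2_inj (adj_neq cd)) [[-> ->]|[-> ->]] //.
by rewrite adj_sym eq_sym.
Qed.

Lemma adj_coord a b : adj a b -> exists i, f b = flip i (f a).
Proof. by rewrite (coords_adj cf) => /hamming1P. Qed.

Lemma flip_coord i k (v : {ffun I -> bool}) : (v k != flip i v k) = (k == i).
Proof. by rewrite ffunE; case: (v k) (k == i) => [] []. Qed.

(** In every coordinate other than [i] the vertices [a] and [b] agree, so both
sums receive the same contribution there; in coordinate [i] one sum receives 2
and the other 0 if [x] and [y] differ, and both receive 1 if they agree. *)
Lemma Theta_coord a b x y i :
  adj a b -> f b = flip i (f a) -> adj x y ->
  (gdist a x + gdist b y != gdist a y + gdist b x) = (f x i != f y i).
Proof.
move=> ab fb xy; have [j fy] := adj_coord xy.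
rewrite !gdist_coords /hamming -!big_split /= (bigD1 i) //= [X in _ != X](bigD1 i) //=.
set s := (X in _ + X != _); set s' := (X in _ != _ + X).
have -> : s' = s.
  by apply: eq_bigr => k /negPf ki; rewrite fb ffunE ki addbF addnC.
rewrite eqn_add2r fb ffunE eqxx.
by case: (f a i) (f x i) (f y i) => [] [] [].
Qed.

Lemma Theta_class_coord a b i :
  adj a b -> f b = flip i (f a) ->
  [set e in edges G | Theta [set a; b] e] = coord_class i.
Proof.
move=> ab fb; apply/setP=> e; rewrite inE.
have [/edgesP[x [y [-> xy]]]|ne] /= := boolP (e \in edges G); last first.
  apply/esym/negP=> /imsetP[[x y]]; rewrite inE /= => /andP[xy _] eE.
  by case/negP: ne; rewrite eE mem_edges.
rewrite mem_coord_class xy; apply/idP/idP => /=; last first.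
  rewrite -(Theta_coord ab fb xy) => abxy.
  by apply/existsP; exists a; apply/existsP; exists b; apply/existsP; exists x;
     apply/existsP; exists y; rewrite !eqxx.
case/existsP=> a' /existsP[b' /existsP[x' /existsP[y']]].
case/and3P=> /eqP Eab /eqP Exy.
have [[-> ->]|[-> ->]] := set2_inj (adj_neq ab) Eab;
have [[-> ->]|[-> ->]] := set2_inj (adj_neq xy) Exy.
- by rewrite (Theta_coord ab fb xy).
- by rewrite eq_sym (Theta_coord ab fb xy).
- by rewrite addnC [X in _ != X]addnC eq_sym (Theta_coord ab fb xy).
- by rewrite addnC [X in _ != X]addnC (Theta_coord ab fb xy).
Qed.

Lemma used_edge i :
  i \in used -> exists a b, [/\ adj a b, f b = flip i (f a) & f a i].
Proof.
rewrite inE => /existsP[a ai]; have [b fb] := coords_drop ai.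
exists a, b; split=> //; rewrite (coords_adj cf) fb.
by apply/hamming1P; exists i.
Qed.

Lemma edge_used a b i : f b = flip i (f a) -> i \in used.
Proof.
move=> fb; rewrite inE; apply/existsP.
have [ai|nai] := boolP (f a i); first by exists a.
by exists b; rewrite fb ffunE eqxx addbT.
Qed.

Lemma Theta_classes_coord : Theta_classes G = coord_class @: used.
Proof.
apply/setP=> c; apply/imsetP/imsetP => [[e /edgesP[a [b [-> ab]]] ->]|[i iU ->]].
  have [i fb] := adj_coord ab; exists i; first exact: edge_used fb.
  exact: Theta_class_coord.
have [a [b [ab fb _]]] := used_edge iU.
by exists [set a; b]; rewrite ?mem_edges ?(Theta_class_coord ab fb).
Qed.

Lemma coord_class_inj : {in used &, injective coord_class}.
Proof.
move=> i j iU _ Eij; have [a [b [ab fb _]]] := used_edge iU.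
have : [set a; b] \in coord_class i by rewrite mem_coord_class ab fb flip_coord eqxx.
by rewrite Eij mem_coord_class ab fb flip_coord eq_sym => /eqP.
Qed.

Lemma isodim_coord : isodim G = #|used|.
Proof. by rewrite /isodim Theta_classes_coord card_in_imset //; apply: coord_class_inj. Qed.

Lemma halfspace_coord a b i :
  f b = flip i (f a) -> halfspace a b = [set x | f x i == f a i].
Proof.
move=> fb; apply/setP=> x; rewrite !inE !gdist_coords.
have [xa|xa] := eqVneq (f x i) (f a i).
  rewrite (@hamming_flip _ i (f b)) ?fb ?flipK //.
    by rewrite ltnSn.
  by rewrite ffunE eqxx xa; case: (f a i).
by rewrite fb (@hamming_flip _ i (f a)) 1?eq_sym // ltnNge leqnSn.
Qed.

(** The halfspaces of the class are the two sides of coordinate [i], which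
together contain all vertices; a vertex meets an edge of the class when its
flip at [i] is again a vertex. *)
Lemma two_sided_coord i :
  i \in used -> two_sided_peripheral (coord_class i) = (i \in free).
Proof.
move=> iU; have incident x :
    [exists e in coord_class i, x \in e] = [exists y, f y == flip i (f x)].
  apply/existsP/existsP => [[e /andP[/imsetP[[a b]]]]|[y /eqP fy]].
    rewrite inE /= => /andP[ab abi] ->; have [j fb] := adj_coord ab.
    have Eij : i = j by apply/eqP; rewrite -(flip_coord j i (f a)) -fb.
    rewrite !inE => /orP[] /eqP ->; [exists b | exists a].
      by rewrite fb Eij.
    by rewrite fb Eij flipK.
  exists [set x; y]; rewrite mem_coord_class set21 andbT fy flip_coord eqxx andbT.
  by rewrite (coords_adj cf); apply/hamming1P; exists i.
have [a [b [ab fb ai]]] := used_edge iU.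
rewrite inE; apply/forall_inP/forallP => [per x|fi W _]; last first.
  by apply/eqP/setP=> x; rewrite inE incident fi andbT.
have side u v : f v = flip i (f u) -> adj u v -> f x i = f u i ->
    [exists y, f y == flip i (f x)].
  move=> fv uv xu; rewrite -incident.
  have /per/eqP/setP/(_ x) : halfspace u v \in halfspaces (coord_class i).
    apply/imsetP; exists (u, v) => //.
    by rewrite inE /= mem_coord_class uv fv flip_coord eqxx.
  by rewrite (halfspace_coord fv) !inE xu eqxx.
(* The edge [ab] gives the side where [i] is on, its reverse the other one. *)
case: (boolP (f x i)) => xi.
  by apply: (side a b) => //; rewrite xi ai.
apply: (side b a); rewrite 1?adj_sym //; first by rewrite fb flipK.
by rewrite fb ffunE eqxx ai (negPf xi).
Qed.

Lemma two_sided_classes_coord : two_sided_classes G = coord_class @: free.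
Proof.
apply/setP=> c; rewrite inE Theta_classes_coord.
apply/andP/imsetP => [[/imsetP[i iU ->]]|[i iF ->]].
  by rewrite two_sided_coord //; exists i.
have iU := subsetP free_sub_used i iF.
by rewrite two_sided_coord // imset_f.
Qed.

Lemma card_two_sided : #|two_sided_classes G| = #|free|.
Proof.
rewrite two_sided_classes_coord card_in_imset // => i j iF jF.
by apply: coord_class_inj; apply: (subsetP free_sub_used).
Qed.

End CoordTheory.

Arguments freeP {G I f i}.

(** * Daisy roots in coordinates *)

Lemma coords_cube n : coords (id : cube n -> {ffun 'I_n -> bool}).
Proof.
split=> // [x y|x v _|]; last by exists (cube0 n).
  by rewrite hammingE.
by exists v.
Qed.

Lemma free_cube n : free (id : cube n -> {ffun 'I_n -> bool}) = [set: 'I_n].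
Proof.
by apply/setP=> i; rewrite in_setT; apply/freeP=> x; exists (flip i x).
Qed.

Section RootCoords.
Variables (G : sgraph) (I : finType) (f : G -> {ffun I -> bool}).
Hypothesis cf : coords f.

(** Both systems describe the same Theta-class, and the halfspaces of an edge of
that class are defined by distances alone. *)
Lemma coord_change (J : finType) (g : G -> {ffun J -> bool}) i :
  coords g -> i \in used f ->
  exists j, forall x y, (f x i == f y i) = (g x j == g y j).
Proof.
move=> cg iU; have [a [b [ab fb _]]] := used_edge cf iU.
have : coord_class f i \in Theta_classes G by rewrite (Theta_classes_coord cf) imset_f.
rewrite (Theta_classes_coord cg) => /imsetP[j _ Eij].
have : [set a; b] \in coord_class f i by rewrite mem_coord_class ab fb flip_coord eqxx.
have [j' gb] := adj_coord cg ab.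
rewrite Eij mem_coord_class ab gb flip_coord => /eqP Ej; rewrite -{}Ej in gb.
exists j => x y.
have side z : (f z i == f a i) = (g z j == g a j).
  have /setP/(_ z) := halfspace_coord cf fb.
  by rewrite (halfspace_coord cg gb) !inE.
move: (side x) (side y).
by case: (f x i) (f y i) (f a i) (g x j) (g y j) (g a j) => [] [] [] [] [] [].
Qed.

(** Below the origin of [g] everything can be switched off, and switching off the
matching coordinate of [g] moves [x] across [i] towards [r]. *)
Lemma coords_zero_free (J : finType) (g : G -> {ffun J -> bool}) r i :
  coords g -> g r = zerov J -> f r i -> i \in free f.
Proof.
move=> cg gr ri; have iU : i \in used f by rewrite inE; apply/existsP; exists r.
apply/freeP=> x; have [xi|nxi] := boolP (f x i); first exact: coords_drop.
have [j change] := coord_change cg iU.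
have xj : g x j.
  by have := change x r; rewrite ri gr ffunE (negPf nxi); case: (g x j).
have [y gy] := coords_drop cg xj; exists y.
have xy : adj x y by rewrite (coords_adj cg) gy; apply/hamming1P; exists j.
have [i' fy] := adj_coord cf xy.
have : f x i != f y i by rewrite change gy flip_coord eqxx.
by rewrite fy flip_coord => /eqP ->.
Qed.

(** The image of [f] is invariant under translation by free coordinates, so
the translated labelling has the same image, which is a down-set. *)
Lemma coords_translate (a : {ffun I -> bool}) :
  (forall i, a i -> i \in free f) -> coords (fun x => shift a (f x)).
Proof.
move=> a_free; split=> [x y /(inv_inj (shiftK a))/(coords_inj cf) //|x y|x v le_v|].
- by rewrite hamming_shift (coords_adj cf).
- have [y fy] := coords_shift x a_free.
  have [|z fz] := coords_down cf y v; first by move=> i; rewrite fy; apply: le_v.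
  have [t ft] := coords_shift z a_free.
  by exists t; rewrite ft shiftK.
- exact: coords_inhab cf.
Qed.

(** Dropping the coordinates that vanish identically makes the dimension equal to
the isometric dimension, as the definition of a daisy root demands. *)
Lemma coords_reindex :
  coords (fun x => [ffun k : 'I_#|used f| => f x (enum_val k)]).
Proof.
have usedP x i : f x i -> exists k : 'I_#|used f|, i = enum_val k.
  move=> xi; have iU : i \in used f by rewrite inE; apply/existsP; exists x.
  by exists (enum_rank_in iU i); rewrite enum_rankK_in.
split=> [x y /ffunP Exy|x y|x v le_v|]; last exact: coords_inhab cf.
- apply: (coords_inj cf); apply/ffunP=> i; apply/idP/idP => xi;
    by have [k Ei] := usedP _ i xi; have := Exy k; rewrite !ffunE -Ei xi.
- rewrite (coords_adj cf) !hammingE -(card_imset _ (@enum_val_inj _ (mem (used f)))).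
  congr (_ == 1); apply: eq_card => i; rewrite inE; apply/idP/imsetP.
    move=> xyi; have [k Ei] : exists k : 'I_#|used f|, i = enum_val k.
      have [xi|nxi] := boolP (f x i); first exact: usedP xi.
      by apply: (usedP y); move: nxi xyi; case: (f x i) (f y i) => [] [].
    by exists k; rewrite // inE !ffunE -Ei.
  by case=> k; rewrite inE !ffunE => xyk ->.
have [|y fy] := coords_down cf x [ffun i => [exists k, v k && (enum_val k == i)]].
  move=> i; rewrite ffunE => /existsP[k /andP[vk /eqP <-]].
  by have := le_v k vk; rewrite ffunE.
exists y; apply/ffunP=> k; rewrite fy !ffunE; apply/existsP/idP.
  by case=> l /andP[vl /eqP/enum_val_inj <-].
by move=> vk; exists k; rewrite vk eqxx.
Qed.

End RootCoords.

Lemma daisy_root_intro (G : sgraph) m (g : G -> {ffun 'I_m -> bool}) r :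
  coords g -> isodim G = m -> g r = zerov 'I_m -> daisy_root r.
Proof.
move=> cg Em; rewrite -{m}Em in g cg * => gr.
apply/existsP; exists ([ffun x => g x] : {ffun G -> cube (isodim G)}); apply/and3P; split.
- apply/forallP=> x; apply/forallP=> y; rewrite !ffunE.
  by rewrite (gdist_coords (coords_cube _)) (gdist_coords cg).
- apply/forall_inP=> u /imsetP[x _ ->]; apply/forallP=> v.
  apply/implyP=> /forallP le_v; have [i vi|y gy] := coords_down cg x v.
    by have := le_v i; rewrite vi ffunE.
  by apply/imsetP; exists y; rewrite ?ffunE ?gy.
- by rewrite ffunE gr.
Qed.

(** The isometric embedding of a daisy root is itself a system of daisy
coordinates; [f] only serves to show that distance determines equality and
adjacency in [G]. *)
Lemma daisy_root_elim (G : sgraph) (I : finType) (f : G -> {ffun I -> bool}) r :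
  coords f -> daisy_root r ->
  exists (m : nat) (g : G -> {ffun 'I_m -> bool}), coords g /\ g r = zerov 'I_m.
Proof.
move=> cf /existsP[lam /and3P[iso_lam down_lam /eqP lam_r]].
exists (isodim G), lam; split; last by rewrite lam_r.
have dE x y : hamming (lam x) (lam y) = hamming (f x) (f y).
  rewrite -(gdist_coords (coords_cube _)) -(gdist_coords cf).
  by apply/eqP; move/forallP/(_ x)/forallP: iso_lam; apply.
split=> [x y Exy|x y|x v le_v|]; last by exists r.
- by apply: (coords_inj cf); apply/eqP; rewrite -hamming_eq0 -dE Exy hamming_eq0.
- by rewrite dE (coords_adj cf).
move/forall_inP/(_ (lam x) (imset_f _ (in_setT x)))/forallP/(_ v): down_lam.
have -> : [forall i, v i ==> lam x i] by apply/forallP=> i; apply/implyP/le_v.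
by case/imsetP=> y _ ->; exists y.
Qed.

(** Necessity is [coords_zero_free]; for sufficiency, translate [r] to the origin
and discard the coordinates that do not occur. *)
Lemma daisy_rootsP (G : sgraph) (I : finType) (f : G -> {ffun I -> bool}) r :
  coords f ->
  reflect (forall i, f r i -> i \in free f) (r \in daisy_roots G).
Proof.
move=> cf; rewrite inE; apply: (iffP idP) => [/(daisy_root_elim cf)[m [g [cg gr]]] i|r_free].
  exact: coords_zero_free cg gr.
have ct := coords_translate cf r_free.
apply: (daisy_root_intro (coords_reindex ct)); first exact: isodim_coord ct.
by apply/ffunP=> k; rewrite !ffunE addbb.
Qed.

Lemma daisy_roots1 (G : sgraph) (I : finType) (f : G -> {ffun I -> bool}) o :
  coords f -> free f = set0 -> f o = zerov I -> daisy_roots G = [set o].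
Proof.
move=> cf free0 fo; apply/setP=> r; rewrite in_set1.
apply/(daisy_rootsP _ cf)/eqP => [r0|-> i]; last by rewrite fo ffunE.
apply: (coords_inj cf); rewrite fo; apply/ffunP=> i; rewrite ffunE.
by apply/negP=> /r0; rewrite free0 inE.
Qed.

(** * Products and isomorphisms *)

Section BoxCoords.
Variables (G H : sgraph) (I J : finType).
Variables (f : G -> {ffun I -> bool}) (g : H -> {ffun J -> bool}).
Hypotheses (cf : coords f) (cg : coords g).

Definition box_coords (u : box G H) : {ffun I + J -> bool} :=
  [ffun k => match k with inl i => f u.1 i | inr j => g u.2 j end].

Lemma hamming_box u v :
  hamming (box_coords u) (box_coords v) =
  hamming (f u.1) (f v.1) + hamming (g u.2) (g v.2).
Proof.
by rewrite /hamming big_sumType /=; congr (_ + _); apply: eq_bigr => k _;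
   rewrite !ffunE.
Qed.

Lemma coords_boxP : coords box_coords.
Proof.
split=> [[x y] [x' y'] /ffunP E|u v|[x y] v le_v|].
- congr (_, _); [apply: (coords_inj cf) | apply: (coords_inj cg)]; apply/ffunP=> k.
    by have := E (inl k); rewrite !ffunE.
  by have := E (inr k); rewrite !ffunE.
- rewrite hamming_box /adj /= /box_adj (coords_adj cf) (coords_adj cg).
  rewrite -(inj_eq (coords_inj cf)) -(inj_eq (coords_inj cg)) -!hamming_eq0.
  by case: (hamming _ _) (hamming _ _) => [|[|m]] [|[|n]].
- have [|x' fx'] := coords_down cf x [ffun i => v (inl i)].
    by move=> i; rewrite ffunE => /le_v; rewrite ffunE.
  have [|y' gy'] := coords_down cg y [ffun j => v (inr j)].
    by move=> j; rewrite ffunE => /le_v; rewrite ffunE.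
  by exists (x', y'); apply/ffunP=> -[i|j]; rewrite ffunE /= ?fx' ?gy' ffunE.
- by have [x _] := coords_inhab cf; have [y _] := coords_inhab cg; exists (x, y).
Qed.

Lemma free_box_l i : (inl i \in free box_coords) = (i \in free f).
Proof.
apply/freeP/freeP => [fi x|fi [x y]].
  have [y _] := coords_inhab cg; have [[x' y'] /ffunP E] := fi (x, y).
  by exists x'; apply/ffunP=> k; have := E (inl k); rewrite !ffunE.
have [x' fx'] := fi x; exists (x', y); apply/ffunP=> -[k|k]; rewrite !ffunE /=.
  by rewrite fx' ffunE.
by rewrite addbF.
Qed.

Lemma free_box_r j : (inr j \in free box_coords) = (j \in free g).
Proof.
apply/freeP/freeP => [fj y|fj [x y]].
  have [x _] := coords_inhab cf; have [[x' y'] /ffunP E] := fj (x, y).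
  by exists y'; apply/ffunP=> k; have := E (inr k); rewrite !ffunE.
have [y' gy'] := fj y; exists (x, y'); apply/ffunP=> -[k|k]; rewrite !ffunE /=.
  by rewrite addbF.
by rewrite gy' ffunE.
Qed.

Lemma card_free_box : #|free box_coords| = #|free f| + #|free g|.
Proof.
rewrite -!sum1_card big_mkcond big_sumType /= -!big_mkcond /=.
by congr (_ + _); apply: eq_bigl => k; rewrite (free_box_l, free_box_r).
Qed.

End BoxCoords.

Section IsoCoords.
Variables (G H : sgraph) (phi : G -> H).
Hypothesis iso_phi : graph_iso phi.
Variables (I : finType) (f : H -> {ffun I -> bool}).

Lemma coords_comp : coords f -> coords (f \o phi).
Proof.
case: iso_phi => [[psi phiK psiK] adj_phi] cf; split=> [x y|x y|x v le_v|] /=.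
- by move/(coords_inj cf)/(can_inj phiK).
- by rewrite -adj_phi (coords_adj cf).
- by have [y fy] := coords_down cf (phi x) v le_v; exists (psi y); rewrite psiK.
- by have [y _] := coords_inhab cf; exists (psi y).
Qed.

Lemma free_comp : free (f \o phi) = free f.
Proof.
case: iso_phi => [[psi phiK psiK] _].
apply/setP=> i; apply/freeP/freeP => fi x /=.
  by have [y fy] := fi (psi x); exists (phi y); rewrite -[x in RHS]psiK.
by have [y fy] := fi (phi x); exists (psi y); rewrite psiK.
Qed.

End IsoCoords.

Lemma daisy_cube_coords (G : sgraph) :
  daisy_cube G <-> exists n (f : G -> {ffun 'I_n -> bool}), coords f.
Proof.
split=> [[n [D [D0 down_D [phi iso_phi]]]]|[n [f cf]]]; exists n.
  exists ((fun u : induced D => val u : cube n) \o phi); apply: coords_comp => //.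
  split=> [x y /val_inj //|x y|x v le_v|].
  - by rewrite hammingE.
  - move/forall_inP/(_ _ (valP x))/forallP/(_ v)/implyP: down_D => Dv.
    have vD : v \in D by apply: Dv; apply/forallP=> i; apply/implyP/le_v.
    by exists (exist _ v vD).
  - by have [x xD] := set0Pn _ D0; exists (exist _ x xD).
have fD x : (f x : cube n) \in [set (f z : cube n) | z in [set: G]] by apply: imset_f.
exists [set (f z : cube n) | z in [set: G]]; split.
- by have [x _] := coords_inhab cf; apply/set0Pn; exists (f x).
- apply/forall_inP=> u /imsetP[x _ ->]; apply/forallP=> v.
  apply/implyP=> /forallP le_v; have [i vi|y fy] := coords_down cf x v.
    by have := le_v i; rewrite vi.
  by apply/imsetP; exists y; rewrite ?fy.
exists (fun x => exist _ (f x : cube n) (fD x)); split.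
  apply: inj_onto_bij => [x y [/(coords_inj cf)]//|[u uD]].
  by have [x _ Eu] := imsetP uD; exists x; apply: val_inj.
by move=> x y; rewrite (coords_adj cf) hammingE.
Qed.

Section BoxFibres.
Variables (G H K : sgraph) (phi : G -> box H K).
Hypothesis iso_phi : graph_iso phi.

(** Expressing the factor as an induced subgraph of [G] lets two decompositions of
[G] be compared inside [G]. *)
Lemma fibre_l (k : K) : isomorphic H (induced [set x | (phi x).2 == k]).
Proof.
case: iso_phi => [[psi phiK psiK] adj_phi].
have memP h : psi (h, k) \in [set x | (phi x).2 == k] by rewrite inE psiK.
exists (fun h => exist _ (psi (h, k)) (memP h)); split.
  apply: inj_onto_bij => [h h' [/(can_inj psiK)[]]//|[x xk]].
  exists (phi x).1; apply: val_inj => /=; move: xk; rewrite inE => /eqP <-.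
  by rewrite -surjective_pairing phiK.
move=> h h'; rewrite [LHS]/adj /= /induced_adj /= -adj_phi !psiK.
by rewrite [LHS]/adj /= /box_adj /= eqxx adj_irrefl andbF.
Qed.

Lemma fibre_r (h : H) : isomorphic (induced [set x | (phi x).1 == h]) K.
Proof.
case: iso_phi => [[psi phiK psiK] adj_phi].
exists (fun u : induced [set x | (phi x).1 == h] => (phi (val u)).2); split.
  apply: inj_onto_bij => [[x xh] [y yh] /= Exy|k].
    apply: val_inj; apply: (can_inj phiK) => /=.
    move: xh yh; rewrite !inE => /eqP xh /eqP yh.
    by rewrite [LHS]surjective_pairing xh Exy -yh -surjective_pairing.
  have kh : psi (h, k) \in [set x | (phi x).1 == h] by rewrite inE psiK.
  by exists (exist _ (psi (h, k)) kh); rewrite /= psiK.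
move=> [x xh] [y yh]; rewrite [RHS]/adj /= /induced_adj /= -adj_phi.
move: xh yh; rewrite !inE => /eqP xh /eqP yh.
by rewrite [RHS]/adj /= /box_adj /= xh yh eqxx adj_irrefl andbF orbF.
Qed.

End BoxFibres.

Section BoxCube.
Variables (G H : sgraph) (b : nat) (phi : G -> box H (cube b)).
Hypothesis iso_phi : graph_iso phi.
Variables (I : finType) (h : H -> {ffun I -> bool}).
Hypothesis ch : coords h.

Let F := box_coords h (id : cube b -> {ffun 'I_b -> bool}).
Let cF : coords (F \o phi) := coords_comp iso_phi (coords_boxP ch (coords_cube b)).

Lemma gdist_box_cube x y :
  gdist x y =
  hamming (h (phi x).1) (h (phi y).1) + @hamming 'I_b (phi x).2 (phi y).2.
Proof. by rewrite (gdist_coords cF) hamming_box. Qed.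

Lemma card_two_sided_box_cube : #|two_sided_classes G| = #|free h| + b.
Proof.
rewrite (card_two_sided cF) (free_comp iso_phi).
by rewrite (card_free_box ch (coords_cube b)) free_cube cardsT card_ord.
Qed.

Lemma daisy_roots_box_cube x :
  (x \in daisy_roots G) = ((phi x).1 \in daisy_roots H).
Proof.
apply/(daisy_rootsP _ cF)/(daisy_rootsP _ ch); rewrite (free_comp iso_phi) => root.
  move=> i xi; have := root (inl i).
  by rewrite (free_box_l _ (coords_cube b)) ffunE; apply.
case=> k; first by rewrite (free_box_l _ (coords_cube b)) ffunE; apply: root.
by rewrite (free_box_r _ ch) free_cube.
Qed.

(** Defined by distances and daisy roots alone, so that it takes the same value
for every decomposition of [G]. *)
Definition gate_set (r : G) : {set G} :=
  [set x | [forall r' in daisy_roots G, gdist x r <= gdist x r']].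

(** All roots have the same first component, so the distance to a root is smallest
when the cube components agree. *)
Lemma gate_set_box_cube rH r :
  daisy_roots H = [set rH] -> r \in daisy_roots G ->
  gate_set r = [set x | (phi x).2 == (phi r).2].
Proof.
move=> rootsH; rewrite daisy_roots_box_cube rootsH inE => /eqP phi_r.
have [[psi phiK psiK] _] := iso_phi.
apply/setP=> x; rewrite !inE; apply/forall_inP/eqP => [near|xr r'].
  (* The competing root is the one whose cube component agrees with that of [x]. *)
  have /near : psi (rH, (phi x).2) \in daisy_roots G.
    by rewrite daisy_roots_box_cube psiK rootsH inE.
  rewrite !gdist_box_cube psiK phi_r /= leq_add2l.
  have -> : @hamming 'I_b (phi x).2 (phi x).2 = 0 by apply/eqP; rewrite hamming_eq0.
  by rewrite leqn0 hamming_eq0 => /eqP.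
rewrite daisy_roots_box_cube rootsH inE => /eqP phi_r'.
rewrite !gdist_box_cube phi_r phi_r' leq_add2l xr.
by have /eqP-> : @hamming 'I_b (phi r).2 (phi r).2 == 0 by rewrite hamming_eq0.
Qed.

End BoxCube.

(** * Splitting off the free coordinates *)

Section Splitting.
Variables (G : sgraph) (I : finType) (f : G -> {ffun I -> bool}).
Hypothesis cf : coords f.

Definition core : {set G} := [set x | [forall i in free f, ~~ f x i]].

Definition clear (v : {ffun I -> bool}) : {ffun I -> bool} :=
  [ffun i => v i && (i \notin free f)].

Lemma coreP x : reflect (forall i, i \in free f -> f x i = false) (x \in core).
Proof.
by rewrite inE; apply: (iffP forall_inP) => xi i /xi => [/negPf|->].
Qed.

Lemma core_coord (x : induced core) : clear (f (val x)) = f (val x).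
Proof.
apply/ffunP=> i; rewrite ffunE; case: (boolP (i \in free f)) => [iF|_].
  by rewrite andbF (coreP _ (valP x)).
by rewrite andbT.
Qed.

Lemma core_clear x : exists y : induced core, f (val y) = clear (f x).
Proof.
have [i|y fy] := coords_down cf x (clear (f x)); first by rewrite ffunE => /andP[].
have yC : y \in core by apply/coreP=> i iF; rewrite fy ffunE iF andbF.
by exists (exist _ y yC).
Qed.

Lemma coords_core : coords (fun x : induced core => f (val x)).
Proof.
split=> [x y /(coords_inj cf)/val_inj //|x y|x v le_v|].
- exact: coords_adj cf _ _.
- have [y fy] := coords_down cf (val x) v le_v.
  have yC : y \in core.
    by apply/coreP=> i iF; apply/negP; rewrite fy => /le_v; rewrite (coreP _ (valP x)).
  by exists (exist _ y yC).
- by have [x _] := coords_inhab cf; have [y _] := core_clear x; exists y.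
Qed.

(** A coordinate that is free in [G] vanishes on the core.  One that is free on
the core is free on all of [G], since every vertex is a core vertex shifted by
free coordinates. *)
Lemma free_core : free (fun x : induced core => f (val x)) = set0.
Proof.
apply/setP=> i; rewrite [RHS]inE; apply/negP=> /freeP fi.
have [iF|/negP] := boolP (i \in free f).
  have [x _] := coords_inhab coords_core; have [y fy] := fi x.
  have := coreP _ (valP y) i iF.
  by rewrite fy ffunE eqxx (coreP _ (valP x)).
case; apply/freeP=> x; have [x0 fx0] := core_clear x.
have [y fy] := fi x0.
have [|z fz] := @coords_shift _ _ f [ffun k => f x k && (k \in free f)] (val y).
  by move=> k; rewrite ffunE => /andP[].
exists z; rewrite fz fy fx0; apply/ffunP=> k; rewrite !ffunE.
by case: (f x k) (k \in free f) (k == i) => [] [] [].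
Qed.

Lemma hamming_split x y :
  hamming (f x) (f y) = hamming (clear (f x)) (clear (f y)) +
    @hamming 'I_#|free f| [ffun k => f x (enum_val k)] [ffun k => f y (enum_val k)].
Proof.
rewrite /hamming [LHS](bigID (mem (free f))) [LHS]addnC /=; congr (_ + _).
  rewrite big_mkcond; apply: eq_bigr => i _; rewrite !ffunE.
  by case: (i \in free f); rewrite ?andbF ?andbT ?eqxx.
by rewrite big_enum_val; apply: eq_bigr => k _; rewrite !ffunE.
Qed.

(** Onto: switching on any set of free coordinates at a core vertex yields a
vertex of [G].  Isometric: the Hamming sum splits over free and other
coordinates. *)
Lemma core_splitting :
  exists phi : G -> box (induced core) (cube #|free f|), graph_iso phi /\
    forall x, (phi x).2 = [ffun k => f x (enum_val k)].
Proof.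
have [c Ec] := fin_all_exists core_clear.
pose q x : cube #|free f| := [ffun k => f x (enum_val k)].
pose phi x : box (induced core) (cube #|free f|) := (c x, q x).
pose F := box_coords (fun x : induced core => f (val x))
            (id : cube #|free f| -> {ffun 'I_#|free f| -> bool}).
have cF : coords F := coords_boxP coords_core (coords_cube #|free f|).
have dE x y : hamming (F (phi x)) (F (phi y)) = hamming (f x) (f y).
  by rewrite hamming_box /= !Ec -hamming_split.
exists phi; split=> //; split; last first.
  by move=> x y; rewrite (coords_adj cF) (coords_adj cf) dE.
apply: inj_onto_bij => [x y Exy|[y v]].
  by apply: (coords_inj cf); apply/eqP; rewrite -hamming_eq0 -dE Exy hamming_eq0.
have [|x fx] := @coords_shift _ _ f
    [ffun i => [exists k, v k && (enum_val k == i)]] (val y).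
  by move=> i; rewrite ffunE => /existsP[k /andP[_ /eqP <-]]; apply: enum_valP.
exists x; congr (_, _).
  apply: (coords_inj coords_core); rewrite Ec fx -[RHS]core_coord.
  apply/ffunP=> i; rewrite !ffunE.
  have [iF|iF] := boolP (i \in free f); rewrite ?andbF //.
  suff -> : [exists k, v k && (enum_val k == i)] = false by rewrite addbF.
  apply/existsP=> -[k /andP[_ /eqP Ei]].
  by case/negP: iF; rewrite -Ei; apply: enum_valP.
apply/ffunP=> k; rewrite !ffunE fx !ffunE (coreP _ (valP y)) ?enum_valP //=.
apply/existsP/idP => [[l /andP[vl /eqP/enum_val_inj <-]] //|vk].
by exists k; rewrite vk eqxx.
Qed.

(** A vertex between two roots has no coordinate on that is off at both of them. *)
Lemma convex_daisy_roots : convex (daisy_roots G).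
Proof.
apply/forall_inP=> x xR; apply/forall_inP=> y yR.
apply/forallP=> z; apply/implyP; rewrite !(gdist_coords cf) => /eqP between.
apply/(daisy_rootsP _ cf)=> i zi.
have [xi|nxi] := boolP (f x i); first exact: (daisy_rootsP _ cf xR).
have [yi|nyi] := boolP (f y i); first exact: (daisy_rootsP _ cf yR).
have := hamming_between between (i := i).
by rewrite (negPf nxi) (negPf nyi) zi => /(_ erefl).
Qed.

End Splitting.

Theorem theorem6 (G : sgraph) (hG : daisy_cube G) :
  (exists G0 : sgraph,
     [/\ daisy_cube G0,
         isomorphic G (box G0 (cube #|two_sided_classes G|)),
         (forall H : sgraph, daisy_cube H ->
            isomorphic G (box H (cube #|two_sided_classes G|)) ->
            isomorphic H G0),
         two_sided_classes G0 = set0 &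
         exists r0 : G0,
           daisy_roots G0 = [set r0] /\
           forall phi : G -> box G0 (cube #|two_sided_classes G|),
             graph_iso phi ->
             phi @: daisy_roots G =
               [set u : box G0 (cube #|two_sided_classes G|) | u.1 == r0]])
  /\ [/\ isomorphic (induced (daisy_roots G)) (cube #|two_sided_classes G|),
         convex (daisy_roots G) &
         #|daisy_roots G| = 2 ^ #|two_sided_classes G|].
Proof.
have [n [f cf]] := (daisy_cube_coords G).1 hG.
have [phi [iso_phi phi2]] := core_splitting cf.
have c0 := coords_core cf; have free0 := free_core cf.
have [o fo] := coords_zero cf; have [r0 fr0] := coords_zero c0.
have roots0 := daisy_roots1 c0 free0 fr0.
have rootsG : daisy_roots G = [set x | (phi x).1 == r0].
  by apply/setP=> x; rewrite (daisy_roots_box_cube iso_phi c0) roots0 !inE.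
have oR : o \in daisy_roots G by apply/(daisy_rootsP _ cf)=> i; rewrite fo ffunE.
have core_gate : core f = gate_set o.
  rewrite (gate_set_box_cube iso_phi c0 roots0 oR); apply/setP=> x.
  rewrite [RHS]inE !phi2; apply/coreP/eqP => [xF|/ffunP Exo i iF].
    by apply/ffunP=> k; rewrite !ffunE fo ffunE xF ?enum_valP.
  have := Exo (enum_rank_in iF i); rewrite !ffunE enum_rankK_in //.
  by rewrite fo ffunE.
have card_free := card_two_sided cf.
have roots_cube : isomorphic (induced (daisy_roots G)) (cube #|free f|).
  by rewrite rootsG; apply: fibre_r.
rewrite card_free; split; first (exists (induced (core f)); split).
- by apply/daisy_cube_coords; exists n, (fun x : induced (core f) => f (val x)).
- by exists phi.
- move=> H /daisy_cube_coords[m [h ch]] [psi iso_psi].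
  have freeH : free h = set0.
    (* Counting two-sided classes of [G] in both ways gives [b = #|free h| + b]. *)
    apply/eqP; rewrite -cards_eq0 -(eqn_add2r #|free f|) add0n.
    by rewrite -(card_two_sided_box_cube iso_psi ch) card_free.
  have [rH hrH] := coords_zero ch.
  rewrite core_gate (gate_set_box_cube iso_psi ch (daisy_roots1 ch freeH hrH) oR).
  exact: fibre_l.
- by apply/eqP; rewrite -cards_eq0 (card_two_sided c0) free0 cards0.
- exists r0; split=> // psi iso_psi; have [[psi' psiK psi'K] _] := iso_psi.
  apply/setP=> u; rewrite [RHS]inE; apply/imsetP/eqP => [[x xR ->]|u1].
    by move: xR; rewrite (daisy_roots_box_cube iso_psi c0) roots0 inE => /eqP.
  exists (psi' u); last by rewrite psi'K.
  by rewrite (daisy_roots_box_cube iso_psi c0) psi'K u1 roots0 inE.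
split=> //; first exact: convex_daisy_roots cf.
have [rho [/bij_eq_card Erho _]] := roots_cube.
by move: Erho; rewrite card_sig card_ffun card_bool card_ord.
Qed.
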